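(* Let $a_{\mathrm{minBrake}},a_{\mathrm{maxBrake}},a_{\mathrm{maxAccel}},\rho$ be real parameters (constants, never changed by the program) and let $x_1,x_2,v_1,v_2,a_1,a_2,t$ be real state variables. Let $v_{1,\rho}=v_1+\rho a_{\mathrm{maxAccel}}$, $v_{2,\rho}=|v_2|+\rho a_{\mathrm{maxAccel}}$ and define $$\mathrm{safeDist}(v_1,v_2)=\frac{v_1+v_{1,\rho}}{2}\rho+\frac{v_{1,\rho}^2}{2a_{\mathrm{minBrake}}}+\frac{|v_2|+v_{2,\rho}}{2}\rho+\frac{v_{2,\rho}^2}{2a_{\mathrm{minBrake}}},$$ the formula $\mathrm{edc}\equiv v_1\ge0\wedge v_2\le 0$, and the hybrid programs $$\mathrm{freeDriving}\equiv a_1:=*;\ ?(-a_{\mathrm{maxBrake}}\le a_1\le a_{\mathrm{maxAccel}});\ a_2:=*;\ ?(-a_{\mathrm{maxAccel}}\le a_2\le a_{\mathrm{maxBrake}}),$$ $$\mathrm{properResponse}\equiv\big((a_1:=*;\ ?(a_1\le -a_{\mathrm{minBrake}}))\cup(?(v_1=0);\ a_1:=0)\big);\ \big((a_2:=*;\ ?(a_2\ge a_{\mathrm{minBrake}}))\cup(?(v_2=0);\ a_2:=0)\big),$$ $$\alpha\equiv\big((?(\mathrm{safeDist}(v_1,v_2)\le x_2-x_1);\ \mathrm{freeDriving})\cup(?(\mathrm{safeDist}(v_1,v_2)\ge x_2-x_1);\ \mathrm{properResponse})\big);\ t:=0;\ \{x_1'=v_1,x_2'=v_2,v_1'=a_1,v_2'=a_2,t'=1\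 \&\ \mathrm{edc}\wedge t\le\rho\}.$$ Let $\mathrm{Init}\equiv x_1\le x_2\wedge \mathrm{safeDist}(v_1,v_2)\le x_2-x_1\wedge 0<a_{\mathrm{minBrake}}<a_{\mathrm{maxBrake}}\wedge 0<a_{\mathrm{maxAccel}}\wedge \rho>0\wedge \mathrm{edc}$. Then the differential dynamic logic formula $\mathrm{Init}\rightarrow[\alpha^*](x_1\le x_2)$ is valid; that is, for every state $\nu$ satisfying $\mathrm{Init}$ and every state $\omega$ with $(\nu,\omega)\in[\![\alpha^*]\!]$, we have $\omega(x_1)\le\omega(x_2)$.
   Context: A state is a map assigning a real number to each variable. Hybrid programs denote transition relations $[\![\cdot]\!]$ on states: $(\nu,\omega)\in[\![x:=\theta]\!]$ iff $\omega$ equals $\nu$ except $\omega(x)$ is the value of $\theta$ in $\nu$; $(\nu,\omega)\in[\![x:=*]\!]$ iff $\omega$ agrees with $\nu$ except possibly at $x$ (any real value); $[\![?P]\!]=\{(\nu,\nu):\nu\models P\}$; $[\![\alpha;\beta]\!]$ is relational composition; $[\![\alpha\cup\beta]\!]=[\![\alpha]\!]\cup[\![\beta]\!]$; $[\![\alpha^*]\!]$ is the reflexive transitive closure of $[\![\alpha]\!]$; $(\nu,\omega)\in[\![\{x'=f(x)\ \&\ Q\}]\!]$ iff there exist $r\ge0$ and a differentiable $\varphi$ from $[0,r]$ to states with $\varphi(0)=\nu$, $\varphi(r)=\omega$, $\varphi$ solving the differential equations on $[0,r]$, all variables not having a differential equation constant, and $\varphi(s)\models Q$ for all $s\in[0,r]$.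 A formula $[\alpha]P$ holds in $\nu$ iff $P$ holds in all $\omega$ with $(\nu,\omega)\in[\![\alpha]\!]$; a formula is valid if it holds in all states. Car 1 drives away from the lane origin and car 2 drives towards it (towards each other). *)

(* Defs.v *)
From Stdlib Require Import Reals List Relations.
Open Scope R_scope.

Section HybridPrograms.

Context {V : Type}.

Definition state : Type := V -> R.
Definition term : Type := state -> R.
Definition formula : Type := state -> Prop.

(** In [ODE sys Q], a pair [(x, f)] of the list [sys] is the equation [x' = f];
    [Q] is the evolution domain constraint. *)
Inductive program : Type :=
| Assign (x : V) (theta : term)
| AssignAny (x : V)
| Test (P : formula)
| Seq (alpha beta : program)
| Choice (alpha beta : program)
| Loop (alpha : program)
| ODE (sys : list (V * term)) (Q : formula).

Definition agree_except (x : V) (nu omega : state) : Prop :=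
  forall y : V, y <> x -> omega y = nu y.

(** Only the values of [phi] on [[0, r]] matter: [D_in] takes the derivative
    relative to that interval, hence one-sided at its endpoints (and no
    condition at all when [r = 0]). *)
Definition solves (sys : list (V * term)) (r : R) (phi : R -> state) : Prop :=
  (forall (x : V) (f : term), In (x, f) sys ->
     forall s : R, 0 <= s <= r ->
       D_in (fun u => phi u x) (fun u => f (phi u)) (fun u => 0 <= u <= r) s) /\
  (forall y : V, ~ In y (map fst sys) ->
     forall s : R, 0 <= s <= r -> phi s y = phi 0 y).

Fixpoint sem (alpha : program) : state -> state -> Prop :=
  match alpha with
  | Assign x theta => fun nu omega =>
      agree_except x nu omega /\ omega x = theta nu
  | AssignAny x => fun nu omega => agree_except x nu omega
  | Test P => fun nu omega => omega = nu /\ P nu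
  | Seq alpha beta => fun nu omega =>
      exists mu : state, sem alpha nu mu /\ sem beta mu omega
  | Choice alpha beta => fun nu omega => sem alpha nu omega \/ sem beta nu omega
  | Loop alpha => clos_refl_trans state (sem alpha)
  | ODE sys Q => fun nu omega =>
      exists (r : R) (phi : R -> state),
        0 <= r /\ phi 0 = nu /\ phi r = omega /\ solves sys r phi /\
        (forall s : R, 0 <= s <= r -> Q (phi s))
  end.

Definition box (alpha : program) (P : formula) : formula :=
  fun nu => forall omega : state, sem alpha nu omega -> P omega.

Definition implies (P Q : formula) : formula := fun nu => P nu -> Q nu.

Definition valid (P : formula) : Prop := forall nu : state, P nu.

End HybridPrograms.

Arguments state : clear implicits.
Arguments term : clear implicits.
Arguments formula : clear implicits.
Arguments program : clear implicits.

Declare Scope program_scope.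
Delimit Scope program_scope with program.
Bind Scope program_scope with program.
Infix ";;" := Seq (at level 60, right associativity) : program_scope.
Infix "++" := Choice (at level 60, right associativity) : program_scope.
Open Scope program_scope.

(** Index 1: the car driving away from the lane origin; index 2: the oncoming
    car, whose velocity is nonpositive. *)
Inductive var : Type := X1 | X2 | V1 | V2 | A1 | A2 | T.

Section TwoCars.

Variables aminBrake amaxBrake amaxAccel rho : R.

Definition safeDist (v1 v2 : R) : R :=
  let v1rho := v1 + rho * amaxAccel in
  let v2rho := Rabs v2 + rho * amaxAccel in
  (v1 + v1rho) / 2 * rho + v1rho ^ 2 / (2 * aminBrake) +
  (Rabs v2 + v2rho) / 2 * rho + v2rho ^ 2 / (2 * aminBrake).

Definition edc : formula var := fun nu => nu V1 >= 0 /\ nu V2 <= 0.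

Definition freeDriving : program var :=
  AssignAny A1 ;; Test (fun nu => - amaxBrake <= nu A1 <= amaxAccel) ;;
  AssignAny A2 ;; Test (fun nu => - amaxAccel <= nu A2 <= amaxBrake).

Definition properResponse : program var :=
  ((AssignAny A1 ;; Test (fun nu => nu A1 <= - aminBrake)) ++
   (Test (fun nu => nu V1 = 0) ;; Assign A1 (fun _ => 0))) ;;
  ((AssignAny A2 ;; Test (fun nu => nu A2 >= aminBrake)) ++
   (Test (fun nu => nu V2 = 0) ;; Assign A2 (fun _ => 0))).

Definition dynamics : program var :=
  ODE ((X1, fun nu => nu V1) :: (X2, fun nu => nu V2) ::
       (V1, fun nu => nu A1) :: (V2, fun nu => nu A2) ::
       (T, fun _ => 1) :: nil)
      (fun nu => edc nu /\ nu T <= rho).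

Definition alpha : program var :=
  ((Test (fun nu => safeDist (nu V1) (nu V2) <= nu X2 - nu X1) ;; freeDriving) ++
   (Test (fun nu => safeDist (nu V1) (nu V2) >= nu X2 - nu X1) ;; properResponse)) ;;
  Assign T (fun _ => 0) ;; dynamics.

Definition Init : formula var := fun nu =>
  nu X1 <= nu X2 /\ safeDist (nu V1) (nu V2) <= nu X2 - nu X1 /\
  0 < aminBrake < amaxBrake /\ 0 < amaxAccel /\ rho > 0 /\ edc nu.

End TwoCars.

(* Main.v *)
Require Import Defs.
From Stdlib Require Import Reals.
From Stdlib Require Import Lra List Relations.
(* Again, because [Reals] shadows the variable [A1]. *)
Import Defs.
Open Scope R_scope.

(** The loop invariant is that both cars can still stop without colliding when
    braking at [aminBrake]:
    [v1^2 / (2 aminBrake) + v2^2 / (2 aminBrake) <= x2 - x1], with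
    [v1 >= 0 >= v2].  The accelerations are constant during each evolution, so
    the motion is explicitly quadratic in time.  The terms of [safeDist] are the
    worst case of an evolution of length at most [rho] followed by braking,
    which covers free driving; under a proper response the braking distance of
    each car decreases at least as fast as the car advances. *)

(** Composing with [clamp r] extends a function on [[0, r]] by its endpoint values, so that results
    about two-sided derivatives apply. *)
Definition clamp (r u : R) : R := Rmax 0 (Rmin u r).

Lemma clamp_in (r u : R) : 0 <= r -> 0 <= clamp r u <= r.
Proof.
  intros Hr. unfold clamp, Rmax, Rmin.
  repeat destruct Rle_dec; lra.
Qed.

Lemma clamp_id (r u : R) : 0 <= u <= r -> clamp r u = u.
Proof.
  intros Hu. unfold clamp, Rmax, Rmin.
  repeat destruct Rle_dec; lra.
Qed.

Lemma clamp_lipschitz (r u w : R) : Rabs (clamp r u - clamp r w) <= Rabs (u - w).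
Proof.
  unfold clamp, Rmax, Rmin, Rabs.
  repeat destruct Rle_dec; repeat destruct Rcase_abs; lra.
Qed.

(* Since [clamp r] is 1-Lipschitz, [f] composed with it has derivative zero on
   the whole real line. *)
Lemma D_in_zero_const (r : R) (f d : R -> R) :
  (forall s, 0 <= s <= r -> D_in f d (fun u => 0 <= u <= r) s) ->
  (forall s, 0 <= s <= r -> d s = 0) ->
  forall s, 0 <= s <= r -> f s = f 0.
Proof.
  intros Hf Hd s Hs.
  assert (Hr : 0 <= r) by lra.
  set (g := fun u => f (clamp r u)).
  assert (Hg : forall x, derivable_pt_lim g x 0).
  { intros x eps Heps.
    pose proof (clamp_in r x Hr) as Hc.
    destruct (Hf _ Hc eps Heps) as [del [Hdel Hlim]].
    exists (mkposreal del Hdel). intros h Hh Hhdel. simpl in Hhdel.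
    unfold g.
    set (c := clamp r x) in *. set (c' := clamp r (x + h)).
    assert (Hlip : Rabs (c' - c) <= Rabs h).
    { pose proof (clamp_lipschitz r (x + h) x) as Hl.
      now replace (x + h - x) with h in Hl by ring. }
    assert (Hpos : 0 < Rabs h) by now apply Rabs_pos_lt.
    assert (Hslope : Rabs (f c' - f c) < eps * Rabs h).
    (* [D_in] says nothing at the base point itself, and [c = c'] does occur: when [x] and [x + h]
       lie beyond the same endpoint. *)
    { destruct (Req_dec c c') as [<- | Hne].
      - rewrite Rminus_diag, Rabs_R0. now apply Rmult_lt_0_compat.
      - assert (Hq : Rabs ((f c' - f c) / (c' - c)) < eps).
        { specialize (Hlim c'). simpl in Hlim. unfold Rdist in Hlim.
          rewrite (Hd c Hc), Rminus_0_r in Hlim. apply Hlim.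
          split; [split; [apply clamp_in |] |]; trivial; lra. }
        assert (0 < Rabs (c' - c)) by (apply Rabs_pos_lt; lra).
        replace (f c' - f c) with ((f c' - f c) / (c' - c) * (c' - c))
          by (field; lra).
        rewrite Rabs_mult.
        apply Rlt_le_trans with (eps * Rabs (c' - c)).
        + now apply Rmult_lt_compat_r.
        + apply Rmult_le_compat_l; lra. }
    rewrite Rminus_0_r. unfold Rdiv. rewrite Rabs_mult, Rabs_inv.
    apply Rmult_lt_reg_r with (Rabs h); trivial.
    rewrite Rmult_assoc, Rinv_l, Rmult_1_r by lra. exact Hslope. }
  assert (Hconst : constant g).
  { apply null_derivative_1 with (fun x => exist _ 0 (Hg x)).
    intros x. reflexivity. }
  specialize (Hconst s 0). unfold g in Hconst.
  rewrite !clamp_id in Hconst by lra. exact Hconst.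
Qed.

(** Subtracting the quadratic with derivative [a + b * s] leaves a function with derivative zero. *)
Lemma D_in_affine (r a b : R) (f d : R -> R) :
  (forall s, 0 <= s <= r -> D_in f d (fun u => 0 <= u <= r) s) ->
  (forall s, 0 <= s <= r -> d s = a + b * s) ->
  forall s, 0 <= s <= r -> f s = f 0 + a * s + b * s ^ 2 / 2.
Proof.
  intros Hf Hd s Hs.
  enough (H : f s - (a * s + b / 2 * (s * s)) = f 0 - (a * 0 + b / 2 * (0 * 0)))
    by lra.
  (* The derivative is left unsimplified, in the exact shape produced by [Dadd], [Dmult_const] and
     [Dmult]. *)
  apply (D_in_zero_const r (fun u => f u - (a * u + b / 2 * (u * u)))
           (fun u => d u - (a * 1 + b / 2 * (1 * u + u * 1)))); trivial.
  - intros u Hu.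
    apply (Dminus _ d (fun u => a * 1 + b / 2 * (1 * u + u * 1)) f
             (fun u => a * u + b / 2 * (u * u))); [now apply Hf |].
    apply (Dadd _ (fun _ => a * 1) (fun u => b / 2 * (1 * u + u * 1))
             (fun u => a * u) (fun u => b / 2 * (u * u))).
    + apply (Dmult_const _ (fun u => u) (fun _ => 1)), Dx.
    + apply (Dmult_const _ (fun u => u * u) (fun u => 1 * u + u * 1)).
      apply (Dmult _ (fun _ => 1) (fun _ => 1) (fun u => u) (fun u => u));
        apply Dx.
  - intros u Hu. rewrite (Hd u Hu). lra.
Qed.

(** The accelerations have no equation, hence are constant; integrating once gives the velocities,
    twice the positions. *)
Lemma dynamics_motion (rho : R) (nu omega : state var) :
  sem (dynamics rho) nu omega -> nu T = 0 ->
  exists s, 0 <= s <= rho /\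
    omega X1 = nu X1 + nu V1 * s + nu A1 * s ^ 2 / 2 /\
    omega X2 = nu X2 + nu V2 * s + nu A2 * s ^ 2 / 2 /\
    omega V1 = nu V1 + nu A1 * s /\
    omega V2 = nu V2 + nu A2 * s /\
    edc omega.
Proof.
  intros (r & phi & Hr & <- & <- & [Hode Hcst] & HQ) HT.
  assert (HA1 : forall s, 0 <= s <= r -> phi s A1 = phi 0 A1)
    by (apply Hcst; simpl; intuition discriminate).
  assert (HA2 : forall s, 0 <= s <= r -> phi s A2 = phi 0 A2)
    by (apply Hcst; simpl; intuition discriminate).
  assert (Hsol : forall (x : var) (f : term var) (a b : R),
    In (x, f) ((X1, fun nu => nu V1) :: (X2, fun nu => nu V2) ::
       (V1, fun nu => nu A1) :: (V2, fun nu => nu A2) ::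
       (T, fun _ => 1) :: nil)%list ->
    (forall s, 0 <= s <= r -> f (phi s) = a + b * s) ->
    forall s, 0 <= s <= r -> phi s x = phi 0 x + a * s + b * s ^ 2 / 2).
  { intros x f a b Hin Hf.
    exact (D_in_affine r a b (fun u => phi u x) (fun u => f (phi u))
             (Hode x f Hin) Hf). }
  assert (HV1 : forall s, 0 <= s <= r -> phi s V1 = phi 0 V1 + phi 0 A1 * s).
  { intros s Hs.
    rewrite (Hsol V1 (fun nu => nu A1) (phi 0 A1) 0); simpl; auto; try lra.
    intros u Hu. rewrite HA1; lra. }
  assert (HV2 : forall s, 0 <= s <= r -> phi s V2 = phi 0 V2 + phi 0 A2 * s).
  { intros s Hs.
    rewrite (Hsol V2 (fun nu => nu A2) (phi 0 A2) 0); simpl; auto; try lra.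
    intros u Hu. rewrite HA2; lra. }
  (* The clock starts at 0 with slope 1, so the domain constraint [t <= rho] bounds the duration. *)
  assert (HTr : phi r T = r).
  { rewrite (Hsol T (fun _ => 1) 1 0); simpl; auto 7; try lra.
    intros; lra. }
  destruct (HQ r) as [Hedc HTrho]; [lra |].
  exists r. repeat split; try lra; try apply Hedc.
  - apply (Hsol X1 (fun nu => nu V1)); simpl; auto; lra.
  - apply (Hsol X2 (fun nu => nu V2)); simpl; auto; lra.
  - apply HV1; lra.
  - apply HV2; lra.
Qed.

(** Distance travelled and final speed both grow with the acceleration. As [a] may be negative, it
    is first raised to [A]; the bounds are then monotone in [s], which is raised to [rho]. *)
Lemma free_stopping_distance (b A rho v a s : R) :
  0 < b -> 0 < A -> 0 <= s <= rho -> 0 <= v -> a <= A -> 0 <= v + a * s ->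
  v * s + a * s ^ 2 / 2 + (v + a * s) ^ 2 / (2 * b) <=
  (v + (v + rho * A)) / 2 * rho + (v + rho * A) ^ 2 / (2 * b).
Proof.
  intros Hb HA Hs Hv Ha Hv'.
  apply Rplus_le_compat.
  - assert (a * s ^ 2 <= A * s ^ 2)
      by (apply Rmult_le_compat_r; [apply pow2_ge_0 | lra]).
    assert (s ^ 2 <= rho ^ 2) by (apply pow_incr; lra).
    assert (A * s ^ 2 <= A * rho ^ 2) by (apply Rmult_le_compat_l; lra).
    assert (v * s <= v * rho) by (apply Rmult_le_compat_l; lra).
    lra.
  - apply Rmult_le_compat_r.
    + left. apply Rinv_0_lt_compat. lra.
    + apply pow_incr. split; trivial.
      assert (a * s <= A * s) by (apply Rmult_le_compat_r; lra).
      assert (A * s <= A * rho) by (apply Rmult_le_compat_l; lra).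
      lra.
Qed.

(** For [a <= - b], right side minus left side factors as [(- b - a) * (s * (v + (v + a * s)) / (2 *
    b))], a product of nonnegative terms. A car kept at rest makes both sides zero. *)
Lemma braking_stopping_distance (b v a s : R) :
  0 < b -> 0 <= s -> 0 <= v -> 0 <= v + a * s -> a <= - b \/ v = 0 /\ a = 0 ->
  v * s + a * s ^ 2 / 2 + (v + a * s) ^ 2 / (2 * b) <= v ^ 2 / (2 * b).
Proof.
  intros Hb Hs Hv Hv' [Ha | [-> ->]].
  - assert (H : 0 <= (- b - a) * (s * (v + (v + a * s)) / (2 * b))).
    { apply Rmult_le_pos; [lra |]. apply Rmult_le_pos.
      - apply Rmult_le_pos; lra.
      - left. apply Rinv_0_lt_compat. lra. }
    apply Rminus_le.
    replace (_ - _) with (- ((- b - a) * (s * (v + (v + a * s)) / (2 * b))))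
      by (field; lra).
    lra.
  - right. field. lra.
Qed.

(** The case of zero duration; it yields the loop invariant in the initial state. *)
Lemma stopping_distance_le_safe (b A rho v : R) :
  0 < b -> 0 < A -> 0 < rho -> 0 <= v ->
  v ^ 2 / (2 * b) <= (v + (v + rho * A)) / 2 * rho + (v + rho * A) ^ 2 / (2 * b).
Proof.
  intros Hb HA Hrho Hv.
  pose proof (free_stopping_distance b A rho v 0 0) as H.
  replace (v + 0 * 0) with v in H by ring. lra.
Qed.

Definition stoppable (b : R) (nu : state var) : Prop :=
  edc nu /\ nu V1 ^ 2 / (2 * b) + nu V2 ^ 2 / (2 * b) <= nu X2 - nu X1.

Lemma alpha_stoppable (b B A rho : R) (nu omega : state var) :
  0 < b -> 0 < A ->
  sem (alpha b B A rho) nu omega -> stoppable b nu -> stoppable b omega.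
Proof.
  intros Hb HA (mu & Hctrl & mu' & [Hmu HT] & Hdyn) [[Hv1 Hv2] Hstop].
  destruct (dynamics_motion rho mu' omega Hdyn HT)
    as (s & Hs & EX1 & EX2 & EV1 & EV2 & Hedc).
  rewrite (Hmu X1), (Hmu V1), (Hmu A1) in EX1 by discriminate.
  rewrite (Hmu X2), (Hmu V2), (Hmu A2) in EX2 by discriminate.
  rewrite (Hmu V1), (Hmu A1) in EV1 by discriminate.
  rewrite (Hmu V2), (Hmu A2) in EV2 by discriminate.
  split; trivial. destruct Hedc as [Hw1 Hw2].
  (* Every control branch writes accelerations only. *)
  assert (Hframe : mu X1 = nu X1 /\ mu X2 = nu X2 /\ mu V1 = nu V1 /\ mu V2 = nu V2).
  { destruct Hctrl as [(k & [-> _] & m1 & H1 & m2 & [-> _] & m3 & H3 & [-> _])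
      | (k & [-> _] & m & [(m1 & H1 & [-> _]) | (m1 & [-> _] & [H1 _])] &
         [(m2 & H2 & [-> _]) | (m2 & [-> _] & [H2 _])])];
    repeat split; clear Hmu;
    repeat match goal with H : sem _ _ _ |- _ => simpl in H end;
    repeat match goal with H : agree_except _ _ _ |- _ =>
      rewrite H by discriminate; clear H end; reflexivity. }
  destruct Hframe as (FX1 & FX2 & FV1 & FV2).
  rewrite FX1, FV1 in EX1. rewrite FX2, FV2 in EX2.
  rewrite FV1 in EV1. rewrite FV2 in EV2.
  (* Car 2 is mirrored: with velocity and acceleration negated, the bounds for a car of nonnegative
     speed apply to it. *)
  replace (omega V2 ^ 2) with ((- nu V2 + - mu A2 * s) ^ 2) by (rewrite EV2; ring).
  rewrite EX1, EX2, EV1.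
  destruct Hctrl as [(k & [-> Hsafe] & m1 & H1 & m2 & [-> Ha1] & m3 & H3 & [-> Ha2])
      | (k & [-> _] & m & Hc1 & Hc2)].
  - rewrite <- (H3 A1) in Ha1 by discriminate.
    unfold safeDist in Hsafe.
    rewrite (Rabs_left1 (nu V2)) in Hsafe by trivial.
    pose proof (free_stopping_distance b A rho (nu V1) (m3 A1) s).
    pose proof (free_stopping_distance b A rho (- nu V2) (- m3 A2) s).
    lra.
  - assert (Ha1 : mu A1 <= - b \/ nu V1 = 0 /\ mu A1 = 0).
    { assert (E : mu A1 = m A1)
        by (destruct Hc2 as [(? & H & [-> _]) | (? & [-> _] & [H _])];
            apply H; discriminate).
      rewrite E.
      destruct Hc1 as [(? & _ & [-> H]) | (? & [-> H] & [_ H'])]; auto. }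
    assert (Ha2 : - mu A2 <= - b \/ - nu V2 = 0 /\ - mu A2 = 0).
    { destruct Hc2 as [(? & _ & [-> H]) | (? & [-> H] & [H0 H'])].
      - left. lra.
      (* The standstill test of car 2 runs after the choice of [a1], so its [V2] has to be traced
         back to [nu]. *)
      - right. rewrite <- (H0 V2), FV2 in H by discriminate. lra. }
    pose proof (braking_stopping_distance b (nu V1) (mu A1) s).
    pose proof (braking_stopping_distance b (- nu V2) (- mu A2) s).
    replace (nu V2 ^ 2) with ((- nu V2) ^ 2) in Hstop by ring.
    lra.
Qed.

Theorem theorem2 (aminBrake amaxBrake amaxAccel rho : R) :
  valid (implies (Init aminBrake amaxBrake amaxAccel rho)
           (box (Loop (alpha aminBrake amaxBrake amaxAccel rho))
                (fun nu : state var => nu X1 <= nu X2))).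
Proof.
  intros nu (_ & Hsafe & [Hb _] & HA & Hrho & Hedc) omega Hloop.
  assert (Hnu : stoppable aminBrake nu).
  { split; trivial. destruct Hedc as [Hv1 Hv2].
    unfold safeDist in Hsafe.
    rewrite (Rabs_left1 (nu V2)) in Hsafe by trivial.
    pose proof (stopping_distance_le_safe aminBrake amaxAccel rho (nu V1)).
    pose proof (stopping_distance_le_safe aminBrake amaxAccel rho (- nu V2)).
    replace (nu V2 ^ 2) with ((- nu V2) ^ 2) by ring.
    lra. }
  assert (Homega : stoppable aminBrake omega).
  (* The other facts about [nu] concern the initial state only and would become premises of the
     induction hypotheses. *)
  { clear - Hb HA Hloop Hnu.
    change (clos_refl_trans _ (sem (alpha aminBrake amaxBrake amaxAccel rho))
              nu omega) in Hloop.
    induction Hloop as [nu omega H | nu | nu mu omega]; auto.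
    exact (alpha_stoppable _ _ _ _ _ _ Hb HA H Hnu). }
  destruct Homega as [_ Hstop].
  (* The gap dominates a sum of nonnegative braking distances, hence is nonnegative. *)
  assert (Hpos : forall v, 0 <= v ^ 2 / (2 * aminBrake)).
  { intros v. apply Rmult_le_pos; [apply pow2_ge_0 |].
    left. apply Rinv_0_lt_compat. lra. }
  pose proof (Hpos (omega V1)). pose proof (Hpos (omega V2)). lra.
Qed.
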